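(* Let $\mathbb K$ be the field of real or complex numbers with its usual topology, and let $\mathbf X$ be a non-empty set. Equip the exponential vector space $\mathcal D(\mathbf X)$ over $\mathbb K$ with the topology of pointwise convergence. Then (1) the addition $+:\mathcal D(\mathbf X)\times\mathcal D(\mathbf X)\to\mathcal D(\mathbf X)$ is continuous; (2) the scalar multiplication $\cdot:\mathbb K\times\mathcal D(\mathbf X)\to\mathcal D(\mathbf X)$ is continuous; (3) the partial order $\le$ is closed. Thus $\mathcal D(\mathbf X)$ with the topology of pointwise convergence is a topological exponential vector space over $\mathbb K$.
   Context: $\mathcal D(\mathbf X)$ is the set of all metrics on $\mathbf X$ together with the constant zero function $O$ on $\mathbf X\times\mathbf X$, with $(\rho+\eta)(x,y)=\rho(x,y)+\eta(x,y)$, $(\alpha\rho)(x,y)=|\alpha|\rho(x,y)$, and $\rho\le\eta$ iff $\rho(x,y)\le\eta(x,y)$ for all $x,y\in\mathbf X$. The topology of pointwise convergence on $\mathcal D(\mathbf X)\subseteq[0,\infty)^{\mathbf X\times\mathbf X}$ is the subspace topology of the product topology, $[0,\infty)$ having the usual topology. An exponential vector space (evs) over a field $K$ is a partially ordered set $(X,\le)$ with a binary operation $+$ and a scalar multiplication $\cdot:K\times X\to X$ such that: ($A_1$) $(X,+)$ is a commutative semigroup with identity $\theta$; ($A_2$) $x\le y$ implies $x+z\le y+z$ and $\alpha x\le\alpha y$ for all $z\in X$, $\alpha\in K$; ($A_3$) (i) $\alpha(x+y)=\alpha x+\alpha y$; (ii) $\alpha(\beta x)=(\alpha\beta)x$;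 (iii) $(\alpha+\beta)x\le\alpha x+\beta x$; (iv) $1x=x$; ($A_4$) $\alpha x=\theta$ iff $\alpha=0$ or $x=\theta$; ($A_5$) $x+(-1)x=\theta$ iff $x\in X_0$, where $X_0$ is the set of minimal elements of $X$; ($A_6$) for each $x\in X$ there is $p\in X_0$ with $p\le x$. A partial order on a topological space $Z$ is closed if its graph $\{(x,y)\in Z\times Z:x\le y\}$ is closed in $Z\times Z$. A topological evs is an evs over $\mathbb K$ (real or complex numbers) with a topology for which addition and scalar multiplication are continuous and the partial order is closed. *)

(* Defs.v *)
From HB Require Import structures.
From mathcomp Require Import all_boot all_order all_algebra.
From mathcomp Require Import complex.
From mathcomp Require Import all_classical all_reals all_analysis.

Set Implicit Arguments.
Unset Strict Implicit.
Unset Printing Implicit Defensive.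

Import Order.TTheory GRing.Theory Num.Theory.
Import numFieldNormedType.Exports.

Local Open Scope classical_set_scope.
Local Open Scope ring_scope.

(* The two admissible scalar fields.  The topology of [scalars R k] is the one
   the library attaches to a [numFieldType], i.e. that of the metric
   |a - b|. *)
Variant scalar_kind := RealScalars | ComplexScalars.

Definition scalars (R : realType) (k : scalar_kind) : numFieldType :=
  match k with
  | RealScalars => R
  | ComplexScalars => R[i]
  end.

(* The norm of [R[i]] takes its values in [R[i]]; [modulus] is real-valued. *)
Definition modulus (R : realType) (k : scalar_kind) : scalars R k -> R :=
  match k with
  | RealScalars => fun a : R => `|a|
  | ComplexScalars => fun a : R[i] => complex.Re `|a|
  end.

Lemma modulus_ge0 (R : realType) (k : scalar_kind) (a : scalars R k) :
  0 <= modulus a.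
Proof.
case: k a => a; first exact: normr_ge0.
by rewrite /modulus normc_def sqrtr_ge0.
Qed.

Definition minimal_elements (Z : Type) (le : Z -> Z -> Prop) : set Z :=
  [set x | forall y, le y x -> y = x].

Record is_evs (K : fieldType) (Z : Type) (add : Z -> Z -> Z) (theta : Z)
    (scale : K -> Z -> Z) (le : Z -> Z -> Prop) : Prop := {
  evs_le_refl : forall x, le x x;
  evs_le_anti : forall x y, le x y -> le y x -> x = y;
  evs_le_trans : forall x y z, le x y -> le y z -> le x z;
  evs_addA : associative add;
  evs_addC : commutative add;
  evs_add0 : left_id theta add;
  evs_le_add : forall x y z, le x y -> le (add x z) (add y z);
  evs_le_scale : forall a x y, le x y -> le (scale a x) (scale a y);
  evs_scaleDr : forall a x y, scale a (add x y) = add (scale a x) (scale a y);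
  evs_scaleA : forall a b x, scale a (scale b x) = scale (a * b) x;
  evs_scaleDl : forall a b x, le (scale (a + b) x) (add (scale a x) (scale b x));
  evs_scale1 : forall x, scale 1 x = x;
  evs_scale_eq0 : forall a x, scale a x = theta <-> a = 0 \/ x = theta;
  evs_minimal : forall x,
    add x (scale (-1) x) = theta <-> minimal_elements le x;
  evs_above_minimal : forall x, exists2 p, minimal_elements le p & le p x
}.

Definition closed_order (Z : topologicalType) (le : Z -> Z -> Prop) : Prop :=
  closed [set p : Z * Z | le p.1 p.2].

Record is_topological_evs (R : realType) (k : scalar_kind)
    (Z : topologicalType) (add : Z -> Z -> Z) (theta : Z)
    (scale : scalars R k -> Z -> Z) (le : Z -> Z -> Prop) : Prop := {
  tevs_evs : is_evs add theta scale le;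
  tevs_add_continuous : continuous (fun p : Z * Z => add p.1 p.2);
  tevs_scale_continuous :
    continuous (fun p : scalars R k * Z => scale p.1 p.2);
  tevs_le_closed : closed_order le
}.

(* [0, +oo[ with the subspace topology of R *)
Definition nnreal (R : realType) : topologicalType :=
  set_type [set r : R | 0 <= r].

Section NonnegativeReals.
Variable R : realType.

Definition nnreal_val (a : nnreal R) : R := set_val a.

Lemma nnreal_ge0 (a : nnreal R) : 0 <= nnreal_val a.
Proof. exact: set_valP a. Qed.

Definition nnreal_of (r : R) (r0 : 0 <= r) : nnreal R :=
  exist _ r (mem_set r0).

Definition nnreal0 : nnreal R := nnreal_of (lexx 0).

Definition nnreal_add (a b : nnreal R) : nnreal R :=
  nnreal_of (addr_ge0 (nnreal_ge0 a) (nnreal_ge0 b)).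

Definition nnreal_scale (k : scalar_kind) (c : scalars R k) (a : nnreal R) :
    nnreal R :=
  nnreal_of (mulr_ge0 (modulus_ge0 c) (nnreal_ge0 a)).

End NonnegativeReals.

Section Metrics.
Variables (R : realType) (X : Type).

Record is_metric (d : X * X -> nnreal R) : Prop := {
  metric_eq0 : forall x y, nnreal_val (d (x, y)) = 0 <-> x = y;
  metric_sym : forall x y, nnreal_val (d (x, y)) = nnreal_val (d (y, x));
  metric_triangle : forall x y z,
    nnreal_val (d (x, z)) <= nnreal_val (d (x, y)) + nnreal_val (d (y, z))
}.

(* [{ptws _ -> _}] carries the product topology, and a [set_type] the
   subspace topology. *)
Definition metrics : set {ptws X * X -> nnreal R} :=
  [set d | is_metric d \/ d = cst (nnreal0 R)].

Definition calD : topologicalType := set_type metrics.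

Definition calD_fun (rho : calD) : X * X -> nnreal R := set_val rho.

Lemma metrics_zero : metrics (cst (nnreal0 R)).
Proof. by right. Qed.

Lemma metrics_add (rho eta : calD) :
  metrics (fun p => nnreal_add (calD_fun rho p) (calD_fun eta p)).
Proof.
suff addP d e : metrics d -> metrics e ->
    metrics (fun p => nnreal_add (d p) (e p)).
  exact: addP (set_valP rho) (set_valP eta).
move=> dP eP.
have nnvalE r (r0 : 0 <= r) : nnreal_val (nnreal_of r0) = r by [].
have add0n (a : nnreal R) : nnreal_add (nnreal0 R) a = a.
  by apply: val_inj; rewrite /= add0r.
have addn0 (a : nnreal R) : nnreal_add a (nnreal0 R) = a.
  by apply: val_inj; rewrite /= addr0.
case: dP => [dM|->]; last first.
  suff -> : (fun p => nnreal_add (cst (nnreal0 R) p) (e p)) = e by [].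
  by apply/funext => p; rewrite add0n.
case: eP => [eM|->]; last first.
  suff -> : (fun p => nnreal_add (d p) (cst (nnreal0 R) p)) = d by left.
  by apply/funext => p; rewrite addn0.
left; split => [x y|x y|x y z]; rewrite !nnvalE.
- split=> [/eqP|xy].
    rewrite paddr_eq0 ?nnreal_ge0// => /andP[/eqP + _].
    by move=> /(metric_eq0 dM).
  by rewrite (metric_eq0 dM x y).2// (metric_eq0 eM x y).2// addr0.
- by rewrite (metric_sym dM) (metric_sym eM).
- rewrite addrACA.
  exact: lerD (metric_triangle dM x y z) (metric_triangle eM x y z).
Qed.

Lemma metrics_scale (k : scalar_kind) (a : scalars R k) (rho : calD) :
  metrics (fun p => nnreal_scale a (calD_fun rho p)).
Proof.
suff scaleP d : metrics d -> metrics (fun p => nnreal_scale a (d p)).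
  exact: scaleP (set_valP rho).
move=> dP.
have nnvalE r (r0 : 0 <= r) : nnreal_val (nnreal_of r0) = r by [].
case: dP => [dM|->]; last first.
  by right; apply/funext => p; apply: val_inj; rewrite /= mulr0.
have [a0|a0] := eqVneq (modulus a) 0.
  by right; apply/funext => p; apply: val_inj; rewrite /= a0 mul0r.
left; split => [x y|x y|x y z]; rewrite !nnvalE.
- split=> [/eqP|xy].
    by rewrite mulf_eq0 (negbTE a0) /= => /eqP/(metric_eq0 dM).
  by rewrite (metric_eq0 dM x y).2// mulr0.
- by rewrite (metric_sym dM).
- by rewrite -mulrDr ler_wpM2l ?modulus_ge0// (metric_triangle dM).
Qed.

Definition calD_of (d : X * X -> nnreal R) (dP : metrics d) : calD :=
  exist _ d (mem_set dP).

Definition calD_zero : calD := calD_of metrics_zero.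

Definition calD_add (rho eta : calD) : calD := calD_of (metrics_add rho eta).

Definition calD_scale (k : scalar_kind) (a : scalars R k) (rho : calD) : calD :=
  calD_of (metrics_scale a rho).

Definition calD_le (rho eta : calD) : Prop :=
  forall x y, nnreal_val (calD_fun rho (x, y)) <= nnreal_val (calD_fun eta (x, y)).

End Metrics.

(* Main.v *)
(* The topology of calD is the initial one for the real-valued evaluations
   rho |-> rho (x, y).  A map into calD is therefore continuous as soon as its
   evaluations are, which reduces addition and scaling to the continuity of the
   operations of R and of the modulus; the graph of the order is the
   intersection over (x, y) of the closed sets eta (x, y) - rho (x, y) >= 0.
   The zero function lies below every metric, hence it is the only minimal
   element, and the axioms of an evs hold pointwise. *)
Require Import Defs.
From HB Require Import structures.
From mathcomp Require Import all_boot all_order all_algebra.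
From mathcomp Require Import complex.
From mathcomp Require Import all_classical all_reals all_analysis.

Import Order.TTheory GRing.Theory Num.Theory.
Import numFieldNormedType.Exports.

Local Open Scope classical_set_scope.
Local Open Scope ring_scope.

Section Modulus.
Context {R : realType} {k : scalar_kind}.
Implicit Types a b : scalars R k.

Lemma modulusM a b : modulus (a * b) = modulus a * modulus b.
Proof.
(* Once a complex scalar is split into real and imaginary parts, [modulus] is convertible to the
   real-valued norm [normc]. *)
case: k a b => [|[a1 a2] [b1 b2]]; first exact: normrM.
exact: ComplexField.Normc.normcM.
Qed.

Lemma ler_modulusD a b : modulus (a + b) <= modulus a + modulus b.
Proof.
by case: k a b => [|[a1 a2] [b1 b2]]; [exact: ler_normD|exact: le_normcD].
Qed.

Lemma modulus_eq0 a : modulus a = 0 <-> a = 0.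
Proof.
case: k a => [a|[a1 a2]].
  by split=> [/normr0_eq0 //|->]; rewrite /modulus normr0.
split=> [|[-> ->]]; last exact: ComplexField.Normc.normc0.
exact: ComplexField.Normc.eq0_normc.
Qed.

Lemma modulus1 : modulus (1 : scalars R k) = 1.
Proof. by case: k; [exact: normr1|exact: ComplexField.Normc.normc1]. Qed.

Lemma modulusN a : modulus (- a) = modulus a.
Proof. by case: k a => [|[a1 a2]]; [exact: normrN|exact: normcN]. Qed.

(** Reverse triangle inequality: subadditivity applied to [(c - d) + d] bounds the difference from
    one side, and evenness of the modulus gives the other. It makes the modulus 1-Lipschitz. *)
Lemma ler_dist_modulus a b : `|modulus a - modulus b| <= modulus (a - b).
Proof.
have le_sub (c d : scalars R k) : modulus c - modulus d <= modulus (c - d).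
  by rewrite lerBlDr -{1}(subrK d c) ler_modulusD.
by rewrite ler_norml le_sub andbT lerNl opprB -(modulusN (a - b)) opprB le_sub.
Qed.

End Modulus.

Lemma modulus_continuous (R : realType) (k : scalar_kind) :
  continuous (@modulus R k).
Proof.
case: k => a; first exact: norm_continuous.
apply/(cvgrPdist_lt (FF := nbhs_filter a)) => e e0.
(* Balls of [R[i]] have their radius in [R[i]], so the real [e] is embedded; the same radius
   suffices by the Lipschitz bound. *)
apply/nbhs_ballP; exists (e%:C%C : scalars R ComplexScalars) => [|b].
  by rewrite /= ltcR.
rewrite -ball_normE /= => ab_e.
apply: (le_lt_trans (ler_dist_modulus a b)); rewrite -ltcR.
have -> // : (modulus (a - b))%:C%C = `|a - b|.
by case: (a - b) => u v.
Qed.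

Section ProductMaps.
Context {T U V : topologicalType}.

Lemma continuous_fst_comp (f : T -> V) :
  continuous f -> continuous (fun p : T * U => f p.1).
Proof. by move=> fc p; apply: (cvg_comp fst f); [exact: cvg_fst|exact: fc]. Qed.

Lemma continuous_snd_comp (f : U -> V) :
  continuous f -> continuous (fun p : T * U => f p.2).
Proof. by move=> fc p; apply: (cvg_comp snd f); [exact: cvg_snd|exact: fc]. Qed.

End ProductMaps.

(** The product topology is the supremum of the topologies induced by the evaluations, so
    convergence in it implies convergence in the [i]-th one, for which evaluation at [i] is
    continuous by construction. *)
Lemma ptws_eval_continuous (I : Type) (T : topologicalType) (i : I) :
  continuous (fun f : {ptws I -> T} => f i).
Proof.
move=> f A fi_A.
have /cvg_sup/(_ i) cvg_i : nbhs f --> f by exact: cvg_id.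
have /cvg_i := @initial_continuous _ _ (fun g : I -> T => g i) f A fi_A.
exact.
Qed.

Section PointwiseTopology.
Context {R : realType} {X : Type}.

(** The evaluation factors as the inclusion into the function space, a projection, and the inclusion
    of the nonnegative reals into [R]. *)
Lemma calD_eval_continuous (p : X * X) :
  continuous (fun rho : calD R X => nnreal_val (calD_fun rho p)).
Proof.
move=> rho.
apply: (@continuous_comp _ _ _ (fun r : calD R X => calD_fun r p)
  (@nnreal_val R)); last exact: initial_continuous.
apply: (@continuous_comp (calD R X) {ptws X * X -> nnreal R} _
  (@calD_fun R X) (fun f => f p)); first exact: initial_continuous.
exact: ptws_eval_continuous.
Qed.

(** The universal properties are applied from the outside in: subspace [calD R X], supremum over
    [p], topology induced by evaluation at [p], subspace [nnreal R]. *)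
Lemma continuous_calD (T : topologicalType) (f : T -> calD R X) :
  (forall p, continuous (fun t => nnreal_val (calD_fun (f t) p))) ->
  continuous f.
Proof.
move=> f_cont; apply: continuous_comp_initial => t.
apply/cvg_sup => p.
apply: (@continuous_comp_initial _ T _ (fun g : X * X -> nnreal R => g p)).
by apply: continuous_comp_initial; exact: f_cont.
Qed.

End PointwiseTopology.

Section Evs.
Context {R : realType} {X : Type}.
Implicit Types rho eta : calD R X.

(** Both [calD R X] and [nnreal R] are subtypes with boolean membership, so their elements are
    determined by the underlying values. *)
Lemma calD_ext rho eta :
  (forall p, nnreal_val (calD_fun rho p) = nnreal_val (calD_fun eta p)) ->
  rho = eta.
Proof.
move=> eqv; apply: val_inj; apply/funext => p; apply: val_inj; exact: eqv.
Qed.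

Lemma calD_addE rho eta p : nnreal_val (calD_fun (calD_add rho eta) p) =
  nnreal_val (calD_fun rho p) + nnreal_val (calD_fun eta p).
Proof. by []. Qed.

Lemma calD_scaleE k (a : scalars R k) rho p :
  nnreal_val (calD_fun (calD_scale a rho) p) =
  modulus a * nnreal_val (calD_fun rho p).
Proof. by []. Qed.

Lemma calD_zeroE p : nnreal_val (calD_fun (calD_zero R X) p) = 0.
Proof. by []. Qed.

Lemma calD_add_continuous :
  continuous (fun p : calD R X * calD R X => calD_add p.1 p.2).
Proof.
apply: continuous_calD => p q.
exact: (@continuousD R R _ _ _ q
  (continuous_fst_comp _ (calD_eval_continuous p) q)
  (continuous_snd_comp _ (calD_eval_continuous p) q)).
Qed.

Lemma calD_scale_continuous (k : scalar_kind) :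
  continuous (fun p : scalars R k * calD R X => calD_scale p.1 p.2).
Proof.
apply: continuous_calD => p q.
exact: (@continuousM R _ _ _ q
  (continuous_fst_comp _ (@modulus_continuous R k) q)
  (continuous_snd_comp _ (calD_eval_continuous p) q)).
Qed.

Lemma calD_le_closed : closed_order (@calD_le R X).
Proof.
rewrite /closed_order.
have -> : [set p : calD R X * calD R X | calD_le p.1 p.2] =
    \bigcap_q (fun p : calD R X * calD R X =>
      nnreal_val (calD_fun p.2 q) - nnreal_val (calD_fun p.1 q))
      @^-1` [set r : R | 0 <= r].
  apply/seteqP; split=> -[rho eta] /= le_p.
    by case=> x y _ /=; rewrite subr_ge0; exact: le_p.
  by move=> x y; rewrite -subr_ge0; exact: (le_p (x, y)).
apply: closed_bigI => q _; apply: preimage_closed; last exact: closed_ge.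
move=> p _.
exact: (@continuousB R R _ _ _ p
  (continuous_snd_comp _ (calD_eval_continuous q) p)
  (continuous_fst_comp _ (calD_eval_continuous q) p)).
Qed.

Lemma calD_le_zero rho : calD_le (calD_zero R X) rho.
Proof. by move=> x y; exact: nnreal_ge0. Qed.

Lemma calD_le_anti rho eta : calD_le rho eta -> calD_le eta rho -> rho = eta.
Proof.
move=> le1 le2; apply: calD_ext => -[x y].
by apply/eqP; rewrite eq_le le1 le2.
Qed.

Lemma minimal_calD rho :
  minimal_elements (@calD_le R X) rho <-> rho = calD_zero R X.
Proof.
split=> [/(_ _ (calD_le_zero rho))->//|-> eta le_eta].
exact: calD_le_anti le_eta (calD_le_zero eta).
Qed.

Lemma calD_is_evs (k : scalar_kind) :
  is_evs (@calD_add R X) (calD_zero R X) (@calD_scale R X k) (@calD_le R X).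
Proof.
split.
- by move=> rho x y.
- exact: calD_le_anti.
- by move=> rho eta xi le1 le2 x y; exact: le_trans (le1 x y) (le2 x y).
- by move=> rho eta xi; apply: calD_ext => p; rewrite !calD_addE addrA.
- by move=> rho eta; apply: calD_ext => p; rewrite !calD_addE addrC.
- by move=> rho; apply: calD_ext => p; rewrite calD_addE calD_zeroE add0r.
- by move=> rho eta xi le1 x y; rewrite !calD_addE lerD2r.
- move=> a rho eta le1 x y; rewrite !calD_scaleE.
  by rewrite ler_wpM2l ?modulus_ge0.
- move=> a rho eta; apply: calD_ext => p.
  by rewrite calD_addE !calD_scaleE calD_addE mulrDr.
- by move=> a b rho; apply: calD_ext => p; rewrite !calD_scaleE modulusM mulrA.
- move=> a b rho x y; rewrite calD_addE !calD_scaleE -mulrDl.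
  by rewrite ler_wpM2r ?nnreal_ge0 ?ler_modulusD.
- by move=> rho; apply: calD_ext => p; rewrite calD_scaleE modulus1 mul1r.
- move=> a rho; split=> [a_rho|[/modulus_eq0 a0|->]]; last 2 first.
  + by apply: calD_ext => p; rewrite calD_scaleE a0 mul0r.
  + by apply: calD_ext => p; rewrite calD_scaleE calD_zeroE mulr0.
  have [a0|a0] := eqVneq (modulus a) 0; first by left; apply/modulus_eq0.
  (* The nonzero factor [modulus a] can be cancelled at each point. *)
  right; apply: calD_ext => p; apply: (mulfI a0).
  by rewrite -calD_scaleE a_rho !calD_zeroE mulr0.
- move=> rho; rewrite minimal_calD; split=> [rho2|->]; last first.
    by apply: calD_ext => p; rewrite calD_addE calD_scaleE calD_zeroE mulr0 addr0.
  apply: calD_ext => p; apply/eqP; rewrite calD_zeroE.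
  (* Since -1 has modulus 1, the hypothesis at [p] says that a nonnegative real added to itself is
     zero. *)
  have /eqP := congr1 (fun xi => nnreal_val (calD_fun xi p)) rho2.
  rewrite calD_addE calD_scaleE calD_zeroE modulusN modulus1 mul1r.
  by rewrite paddr_eq0 ?nnreal_ge0 // andbb.
- move=> rho; exists (calD_zero R X); last exact: calD_le_zero.
  exact/minimal_calD.
Qed.

End Evs.

Theorem theorem3p3 (R : realType) (k : scalar_kind) (X : Type)
    (X_nonempty : inhabited X) :
  [/\ continuous (fun p : calD R X * calD R X => calD_add p.1 p.2),
      continuous (fun p : scalars R k * calD R X => calD_scale p.1 p.2),
      closed_order (@calD_le R X) &
      is_topological_evs (@calD_add R X) (calD_zero R X)
        (@calD_scale R X k) (@calD_le R X)].
Proof.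
have add_cont := @calD_add_continuous R X.
have scale_cont := @calD_scale_continuous R X k.
have le_closed := @calD_le_closed R X.
by split=> //; split=> //; exact: calD_is_evs.
Qed.
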